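(* Let $L$ be a lattice. Then the following assertions are equivalent: (i) there exists a poset $P$ such that $L$ embeds (as a lattice) into $\mathbf{Co}(P)$; (ii) $L$ satisfies the identities (S), (U), and (B); (iii) there exists a tree-like poset $\Gamma$ such that $L$ has a lattice embedding into $\mathbf{Co}(\Gamma)$ that preserves the existing bounds, and such that, furthermore, if $L$ is finite without $D$-cycle, then $\Gamma$ is finite.
   Context: For a poset $\langle P,\trianglelefteq\rangle$, a subset $X\subseteq P$ is order-convex if $x\trianglelefteq z\trianglelefteq y$ and $x,y\in X$ imply $z\in X$, for all $x,y,z\in P$. $\mathbf{Co}(P)$ denotes the lattice of all order-convex subsets of $P$, ordered by inclusion. An embedding of $L$ into $\mathbf{Co}(\Gamma)$ preserves the existing bounds if it sends the least element of $L$ (if it exists) to $\varnothing$ and the greatest element of $L$ (if it exists) to $\Gamma$. Let $\prec$ be the predecessor (covering) relation of a poset $\langle P,\trianglelefteq\rangle$. A path of $P$ is a finite sequence $\langle x_0,\dots,x_{n-1}\rangle$ of distinct elements of $P$ such that either $x_i\prec x_{i+1}$ or $x_{i+1}\prec x_i$ for all $0\leq i\leq n-2$; if $n>0$, it is a path from $x_0$ to $x_{n-1}$. The poset $P$ is tree-like if (1) for all $a\trianglelefteq b$ in $P$ there are $n<\omega$ and $x_0,\dots,x_n\in P$ with $a=x_0\prec x_1\prec\cdots\prec x_n=b$; and (2) for all $a,b\in P$ there exists at most one path from $a$ to $b$. Let $\mathrm{J}(L)$ be the set of join-irreducible (in particular nonzero) elements of $L$. For $p,q\in\mathrm{J}(L)$,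 write $p\mathbin{D}q$ if $p\neq q$ and there is $x\in L$ such that $p\leq q\vee x$ and $p\nleq y\vee x$ for all $y<q$. A $D$-cycle is a finite sequence $p_0,\dots,p_{n-1}$ ($n\geq 2$) in $\mathrm{J}(L)$ with $p_0\mathbin{D}p_1\mathbin{D}\cdots\mathbin{D}p_{n-1}\mathbin{D}p_0$. The lattice identities (S), (U), (B) are the following. (S), in the variables $a,b,b_0,b_1,c$: $$a\wedge(b'\vee c)=(a\wedge b')\vee\bigvee_{i<2}\Bigl(a\wedge(b_i\vee c)\wedge\bigl((b'\wedge(a\vee b_i))\vee c\bigr)\Bigr),\quad\text{where } b'=b\wedge(b_0\vee b_1).$$ (U), in the variables $x,x_0,x_1,x_2$: $$x\wedge(x_0\vee x_1)\wedge(x_1\vee x_2)\wedge(x_0\vee x_2)=(x\wedge x_0\wedge(x_1\vee x_2))\vee(x\wedge x_1\wedge(x_0\vee x_2))\vee(x\wedge x_2\wedge(x_0\vee x_1)).$$ (B), in the variables $x,a_0,a_1,b_0,b_1$: $$x\wedge(a_0\vee a_1)\wedge(b_0\vee b_1)=\bigvee_{i<2}\Bigl(\bigl(x\wedge a_i\wedge(b_0\vee b_1)\bigr)\vee\bigl(x\wedge b_i\wedge(a_0\vee a_1)\bigr)\Bigr)\vee\bigvee_{i<2}\bigl(x\wedge(a_0\vee a_1)\wedge(b_0\vee b_1)\wedge(a_0\vee b_i)\wedge(a_1\vee b_{1-i})\bigr).$$ *)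

(* Defs.v *)
From HB Require Import structures.
From mathcomp Require Import all_boot all_order.
From mathcomp Require Import boolp classical_sets cardinality.

Set Implicit Arguments.
Unset Strict Implicit.
Unset Printing Implicit Defensive.

Import Order.TTheory.

Local Open Scope classical_set_scope.
Local Open Scope order_scope.

Definition order_convex (d : Order.disp_t) (P : porderType d) (X : set P) :=
  forall x y z : P, X x -> X y -> x <= z -> z <= y -> X z.

Record Co (d : Order.disp_t) (P : porderType d) := MkCo {
  Co_set :> set P;
  Co_setP : `[< order_convex Co_set >] }.

HB.instance Definition _ d (P : porderType d) := [isSub for @Co_set d P].
HB.instance Definition _ d (P : porderType d) := [Choice of Co P by <:].
HB.instance Definition _ d (P : porderType d) :=
  [SubChoice_isSubPOrder of Co P by <: with set_display].

Section CoLattice.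
Context (d : Order.disp_t) (P : porderType d).
Implicit Types (A B C : Co P) (X : set P).

Definition convex_hull X : set P :=
  [set z | exists x y, [/\ X x, X y, x <= z & z <= y]].

Lemma Co_convex A : order_convex A.
Proof. exact/asboolP/Co_setP. Qed.

Lemma order_convexI A B : `[< order_convex (A `&` B)%classic >].
Proof.
apply/asboolP => x y z [Ax Bx] [Ay By] xz zy.
by split; [exact: (@Co_convex A x y)|exact: (@Co_convex B x y)].
Qed.

Lemma order_convex_hull X : `[< order_convex (convex_hull X) >].
Proof.
apply/asboolP => x y z [x1 [_ [Xx1 _ x1x _]]] [_ [y2 [_ Xy2 _ yy2]]] xz zy.
by exists x1, y2; split; rewrite // ?(le_trans x1x) ?(le_trans zy).
Qed.

Definition Co_meet A B : Co P := MkCo (order_convexI A B).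
Definition Co_join A B : Co P := MkCo (order_convex_hull (A `|` B)%classic).

Lemma Co_leP A B : reflect (A `<=` B) (A <= B).
Proof. by rewrite -Order.le_val; exact: asboolP. Qed.

Lemma Co_meetP A B C : (A <= Co_meet B C) = (A <= B) && (A <= C).
Proof.
apply/Co_leP/andP => [ABC|[/Co_leP AB /Co_leP AC] x Ax].
  by split; apply/Co_leP => x /ABC[].
by split; [exact: AB|exact: AC].
Qed.

Lemma Co_joinP A B C : (Co_join A B <= C) = (A <= C) && (B <= C).
Proof.
apply/Co_leP/andP => [ABC|[/Co_leP AC /Co_leP BC] z].
  by split; apply/Co_leP => x Xx; apply: ABC; exists x, x; split => //;
    [left|left|right|right].
have UC x : (A `|` B)%classic x -> (C : set P) x by case=> [/AC|/BC].
by case=> x [y [/UC Cx /UC Cy xz zy]]; exact: (@Co_convex C x y).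
Qed.

HB.instance Definition _ :=
  Order.POrder_MeetJoin_isLattice.Build set_display (Co P) Co_meetP Co_joinP.

End CoLattice.

Definition preserves_existing_bounds (d d' : Order.disp_t) (L : latticeType d)
    (P : porderType d') (f : L -> Co P) :=
  (forall z : L, (forall x, z <= x) -> f z = set0 :> set P) /\
  (forall z : L, (forall x, x <= z) -> f z = setT :> set P).

Definition pred_rel (d : Order.disp_t) (P : porderType d) (x y : P) : bool :=
  (x < y) && ~~ `[< exists z : P, x < z < y >].

(* The nonempty path x :: s, from x to y. *)
Definition path_from_to (d : Order.disp_t) (P : porderType d) (x y : P)
    (s : seq P) : bool :=
  [&& path (fun u v => pred_rel u v || pred_rel v u) x s,
      uniq (x :: s) & last x s == y].

Definition tree_like (d : Order.disp_t) (P : porderType d) :=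
  (forall a b : P, a <= b -> exists s, path (@pred_rel d P) a s /\ last a s = b)
  /\
  (forall (a b : P) (s t : seq P),
      path_from_to a b s -> path_from_to a b t -> s = t).

Definition join_irreducible (d : Order.disp_t) (L : latticeType d) (p : L) :=
  ~ (forall x, p <= x) /\ (forall x y, p = x `|` y -> p = x \/ p = y).

(* Meant for join-irreducible p and q; D_cycle restricts it to these. *)
Definition D_rel (d : Order.disp_t) (L : latticeType d) (p q : L) :=
  p <> q /\
  exists x : L, p <= q `|` x /\ (forall y, y < q -> ~~ (p <= y `|` x)).

Definition D_cycle (d : Order.disp_t) (L : latticeType d) (s : seq L) :=
  [/\ (2 <= size s)%N, (forall p, p \in s -> join_irreducible p)
    & cycle (fun p q => `[< D_rel p q >]) s].

Definition identity_S (d : Order.disp_t) (L : latticeType d) :=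
  forall a b b0 b1 c : L,
    let b' := b `&` (b0 `|` b1) in
    let r bi := a `&` (bi `|` c) `&` ((b' `&` (a `|` bi)) `|` c) in
    a `&` (b' `|` c) = (a `&` b') `|` (r b0 `|` r b1).

Definition identity_U (d : Order.disp_t) (L : latticeType d) :=
  forall x x0 x1 x2 : L,
    x `&` (x0 `|` x1) `&` (x1 `|` x2) `&` (x0 `|` x2) =
    (x `&` x0 `&` (x1 `|` x2)) `|` (x `&` x1 `&` (x0 `|` x2))
      `|` (x `&` x2 `&` (x0 `|` x1)).

Definition identity_B (d : Order.disp_t) (L : latticeType d) :=
  forall x a0 a1 b0 b1 : L,
    let a01 := a0 `|` a1 in
    let b01 := b0 `|` b1 in
    x `&` a01 `&` b01 =
    (((x `&` a0 `&` b01) `|` (x `&` b0 `&` a01))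
      `|` ((x `&` a1 `&` b01) `|` (x `&` b1 `&` a01)))
    `|` ((x `&` a01 `&` b01 `&` (a0 `|` b0) `&` (a1 `|` b1))
      `|` (x `&` a01 `&` b01 `&` (a0 `|` b1) `&` (a1 `|` b0))).

(* Main.v *)
Require Import Defs.
From HB Require Import structures.
From mathcomp Require Import all_boot all_order ssralg ssrint zify.
From mathcomp Require Import boolp classical_sets cardinality.

(**
In Co(P) the three identities are checked pointwise: membership of z in A `|` B
only depends on whether z lies above, resp. below, elements of A and of B, so
(U) and (B) become propositional tautologies.

Conversely, let K be L if L is finite, and the lattice of nonempty filters of L
under reverse inclusion otherwise.  There, whenever p <= x `|` y with p
join-irreducible, either p <= x, or p <= y, or p <= q `|` r for a minimal pair
of join-irreducibles q <= x and r <= y.  By (U) and (B) the minimal pairs of a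
given p form a complete bipartite graph.  By (S) and (U), if (p, x) is a minimal
pair of o, then p <= x `|` q holds exactly for the elements q on one side of the
graph of p, and by (B) this side does not depend on x.

The nodes of Gamma are the lists p_n, ..., p_0 in which each p_i+1 belongs to
a minimal pair of p_i.  Each node has its children on one side of the graph of
p_n above it and those on the other side below it, a child q of p, itself a child
of o, being on the same side as p was exactly when p <= x `|` q for the partners
x of p with respect to o.  An element x of K is sent to the set of lists with
head at most x.  Joins are preserved since every p <= q `|` r gives two children
on opposite sides.  Convexity is the inequality p_i <= p_0 `|` p_n along monotone
paths; such a path rises to a common ancestor and then descends, so that the
inequality follows from (S) along each branch and from (U) and (B) at the fork.
*)

Set Implicit Arguments.
Unset Strict Implicit.
Unset Printing Implicit Defensive.

Import Order.TTheory.

Local Open Scope classical_set_scope.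
Local Open Scope order_scope.

(** * The identities in lattices of order-convex sets *)

Section TrivialInequalities.
Context (d : Order.disp_t) (L : latticeType d).

Lemma identity_S_ge (a b' c b0 b1 : L) :
  (a `&` b') `|` (a `&` (b0 `|` c) `&` ((b' `&` (a `|` b0)) `|` c)
    `|` a `&` (b1 `|` c) `&` ((b' `&` (a `|` b1)) `|` c)) <= a `&` (b' `|` c).
Proof.
pose r bi := a `&` (bi `|` c) `&` ((b' `&` (a `|` bi)) `|` c).
have ler bi : r bi <= a `&` (b' `|` c).
  by rewrite lexI (le_trans (leIl _ _)) ?leIl //= (le_trans (leIr _ _)) // leU2 // leIl.
by rewrite -/(r b0) -/(r b1) !leUx !ler leI2 // leUl.
Qed.

Lemma identity_U_ge (x x0 x1 x2 : L) :
  (x `&` x0 `&` (x1 `|` x2)) `|` (x `&` x1 `&` (x0 `|` x2))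
    `|` (x `&` x2 `&` (x0 `|` x1)) <=
  x `&` (x0 `|` x1) `&` (x1 `|` x2) `&` (x0 `|` x2).
Proof.
have le4 (a u v t : L) : [/\ x `&` a `&` u <= x, x `&` a `&` u <= a `|` v,
    x `&` a `&` u <= t `|` a & x `&` a `&` u <= u].
  split; last exact: leIr; first by rewrite (le_trans (leIl _ _) (leIl _ _)).
    exact: le_trans (leIl _ _) (le_trans (leIr _ _) (leUl _ _)).
  exact: le_trans (leIl _ _) (le_trans (leIr _ _) (leUr _ _)).
rewrite !leUx; apply/andP; split; first (apply/andP; split).
- by have [h1 h2 _ h3] := le4 x0 (x1 `|` x2) x1 x0;
    have [_ h4 _ _] := le4 x0 (x1 `|` x2) x2 x0; rewrite !lexI h1 h2 h3 h4.
- by have [h1 h2 h3 h4] := le4 x1 (x0 `|` x2) x2 x0; rewrite !lexI h1 h2 h3 h4.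
- by have [h1 _ h2 h3] := le4 x2 (x0 `|` x1) x0 x0;
    have [_ _ h4 _] := le4 x2 (x0 `|` x1) x0 x1; rewrite !lexI h1 h2 h3 h4.
Qed.

Lemma identity_B_ge (x a0 a1 b0 b1 a01 b01 : L) :
  a01 = a0 `|` a1 -> b01 = b0 `|` b1 ->
  (((x `&` a0 `&` b01) `|` (x `&` b0 `&` a01))
      `|` ((x `&` a1 `&` b01) `|` (x `&` b1 `&` a01)))
    `|` ((x `&` a01 `&` b01 `&` (a0 `|` b0) `&` (a1 `|` b1))
      `|` (x `&` a01 `&` b01 `&` (a0 `|` b1) `&` (a1 `|` b0))) <=
  x `&` a01 `&` b01.
Proof.
move=> a01E b01E.
have lea a b : a <= a01 -> b = b01 -> x `&` a `&` b <= x `&` a01 `&` b01.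
  by move=> aa ->; rewrite leI2 // leI2.
have leb a b : a <= b01 -> b = a01 -> x `&` a `&` b <= x `&` a01 `&` b01.
  by move=> aa ->; rewrite (meetAC x a01) leI2 // leI2.
rewrite !leUx !(le_trans (leIl _ (_ `|` _)) (leIl _ (_ `|` _))) !andbT.
by apply/andP; split; apply/andP; split;
  solve [by apply: lea; rewrite // a01E ?leUl ?leUr
        |by apply: leb; rewrite // b01E ?leUl ?leUr].
Qed.

End TrivialInequalities.

Section CoIdentities.
Context (d : Order.disp_t) (P : porderType d).
Implicit Types (A B C : Co P) (z : P).

(** To be read with [A] as the subject: [A] has an element above [z]. *)
Definition above A z : bool := `[< exists2 x, Co_set A x & z <= x >].
Definition below A z : bool := `[< exists2 x, Co_set A x & x <= z >].

Lemma Co_inE A z : Co_set A z = (below A z && above A z) :> Prop.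
Proof.
apply/propext; split=> [Az|/andP[/asboolP[x Ax xz] /asboolP[y Ay zy]]].
  by apply/andP; split; apply/asboolP; exists z.
exact: (@Co_convex _ _ A x y).
Qed.

Lemma Co_in_joinE A B z : Co_set (A `|` B) z =
  ((below A z || below B z) && (above A z || above B z)) :> Prop.
Proof.
apply/propext; split=> [[x [y [ABx ABy xz zy]]]|/andP[/orP ABz /orP ABz']].
  by apply/andP; split; apply/orP; [case: ABx|case: ABy] => ?;
    [left|right|left|right]; apply/asboolP; [exists x|exists x|exists y|exists y].
have [x [ABx xz]] : exists x, (Co_set A x \/ Co_set B x) /\ x <= z.
  by case: ABz => /asboolP[x ? ?]; exists x; split=> //; [left|right].
have [y [ABy zy]] : exists y, (Co_set A y \/ Co_set B y) /\ z <= y.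
  by case: ABz' => /asboolP[y ? ?]; exists y; split=> //; [left|right].
by exists x, y.
Qed.

Lemma Co_in_joinl A B z : Co_set A z -> Co_set (A `|` B) z.
Proof. by move=> Az; exists z, z; split=> //; left. Qed.

Lemma Co_in_joinr A B z : Co_set B z -> Co_set (A `|` B) z.
Proof. by move=> Bz; exists z, z; split=> //; right. Qed.

Lemma Co_identity_U : identity_U (Co P).
Proof.
move=> x x0 x1 x2; apply/le_anti/andP; split; last first.
  exact: identity_U_ge.
apply/Co_leP => z [[[xz z01] z12] z02].
(* At most one of the three sets has no element below [z], and at most one has none above it; so one
   of them has both and contains [z]. *)
have : [\/ Co_set x0 z /\ Co_set (x1 `|` x2) z,
           Co_set x1 z /\ Co_set (x0 `|` x2) z |
           Co_set x2 z /\ Co_set (x0 `|` x1) z].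
  move: z01 z12 z02; rewrite !Co_in_joinE !Co_inE; case: (below x0 z); case: (below x1 z);
  case: (below x2 z); case: (above x0 z); case: (above x1 z);
  case: (above x2 z) => //= _ _ _;
  solve [by apply: Or31|by apply: Or32|by apply: Or33].
case=> -[xiz xjkz].
- by apply: Co_in_joinl; apply: Co_in_joinl.
- by apply: Co_in_joinl; apply: Co_in_joinr.
- by apply: Co_in_joinr.
Qed.

Lemma Co_identity_B : identity_B (Co P).
Proof.
move=> x a0 a1 b0 b1 a01 b01; apply/le_anti/andP; split; last first.
  exact: identity_B_ge.
apply/Co_leP => z [[xz a01z] b01z].
(* If none of the four contains [z], one [ai] and one [bj] reach only below [z] and the other two
   only above; the joins pair opposite ones. *)
have : [\/ Co_set a0 z, Co_set b0 z, Co_set a1 z | Co_set b1 z] \/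
       (Co_set (a0 `|` b0) z /\ Co_set (a1 `|` b1) z \/
        Co_set (a0 `|` b1) z /\ Co_set (a1 `|` b0) z).
  move: a01z b01z; rewrite !Co_in_joinE !Co_inE.
  case: (below a0 z); case: (below a1 z); case: (below b0 z);
  case: (below b1 z); case: (above a0 z); case: (above a1 z);
  case: (above b0 z); case: (above b1 z) => //= _ _;
  solve [by left; apply: Or41|by left; apply: Or42|by left; apply: Or43
        |by left; apply: Or44|by right; left|by right; right].
case=> [[a0z|b0z|a1z|b1z]|[[ab0 ab1]|[ab0 ab1]]].
- by do 3!apply: Co_in_joinl.
- by do 2!apply: Co_in_joinl; apply: Co_in_joinr.
- by apply: Co_in_joinl; apply: Co_in_joinr; apply: Co_in_joinl.
- by apply: Co_in_joinl; apply: Co_in_joinr; apply: Co_in_joinr.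
- by apply: Co_in_joinr; apply: Co_in_joinl.
- by apply: Co_in_joinr; apply: Co_in_joinr.
Qed.

Lemma Co_identity_S : identity_S (Co P).
Proof.
move=> a b b0 b1 c b' r; apply/le_anti/andP; split; last first.
  exact: identity_S_ge.
(* For [w <= z <= y <= t] or its dual: [z] is between [w] and [t]; [y] is between [z] and [t], hence
   in the join of [a] and [bi]; and [z] is between [w] and [y]. *)
have between bi y t w z : Co_set a z -> Co_set b' y -> Co_set bi t ->
    Co_set c w -> (z <= y <= t) && (w <= z) || (t <= y <= z) && (z <= w) ->
    (r bi : set P) z.
  move=> az b'y bit cw zP; split; first split=> //.
    case/orP: zP => /andP[/andP[h1 h2] h3]; [exists w, t|exists t, w];
      split=> //; solve [by left|by right|exact: le_trans h1 h2].
  have abiy : Co_set (a `|` bi) y.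
    by case/orP: zP => /andP[/andP[h1 h2] h3]; [exists z, t|exists t, z];
      split=> //; solve [by left|by right].
  by case/orP: zP => /andP[/andP[h1 h2] h3]; [exists w, y|exists y, w];
    split=> //; solve [by left|by right].
apply/Co_leP => z [az [y [w [yP wP yz zw]]]].
have [b'z|nb'z] := pselect (Co_set b' z); first by apply: Co_in_joinl.
have [cz|ncz] := pselect (Co_set c z).
  apply/Co_in_joinr/Co_in_joinl; split; last exact: Co_in_joinr.
  by split=> //; exact: Co_in_joinr.
apply: Co_in_joinr.
(* A point of [b'] lies between points of [b0] or [b1]; the one on the side away from [z] serves as
   [t]. *)
have in_r y' w' : Co_set b' y' -> Co_set c w' ->
    (w' <= z) && (z <= y') || (y' <= z) && (z <= w') -> Co_set (r b0 `|` r b1) z.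
  move=> b'y' cw'; have [_ [t0 [t1 [t0P t1P t0y' y't1]]]] := b'y'.
  case/orP=> /andP[h1 h2].
    by case: t1P => [b0t|b1t]; [apply: Co_in_joinl|apply: Co_in_joinr];
      apply: (between _ y' t1 w'); rewrite ?h1 ?h2 ?y't1.
  by case: t0P => [b0t|b1t]; [apply: Co_in_joinl|apply: Co_in_joinr];
    apply: (between _ y' t0 w'); rewrite ?h1 ?h2 ?t0y' ?orbT.
case: yP wP => [b'y|cy] [b'w|cw].
- by case: nb'z; exact: (@Co_convex _ _ b' y w).
- by apply: (in_r y w); rewrite ?yz ?zw ?orbT.
- by apply: (in_r w y); rewrite ?yz ?zw.
- by case: ncz; exact: (@Co_convex _ _ c y w).
Qed.

End CoIdentities.

Lemma identities_embedding (d d' : Order.disp_t) (L : latticeType d)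
    (K : latticeType d') (f : {lmorphism L -> K}) : injective f ->
  [/\ identity_S K, identity_U K & identity_B K] ->
  [/\ identity_S L, identity_U L & identity_B L].
Proof.
move=> injf [SK UK BK].
have fI x y : f (x `&` y) = f x `&` f y by rewrite omorphI.
have fU x y : f (x `|` y) = f x `|` f y by rewrite omorphU.
split.
- by move=> a b b0 b1 c /=; apply: injf; rewrite !(fI, fU); exact: SK.
- by move=> x x0 x1 x2; apply: injf; rewrite !(fI, fU); exact: UK.
- by move=> x a0 a1 b0 b1 /=; apply: injf; rewrite !(fI, fU); exact: BK.
Qed.

(** * Minimal pairs *)

Section MinimalPairs.
Context (d : Order.disp_t) (K : latticeType d).
Implicit Types o p q r s u v x y : K.

(** Minimality is asked in each coordinate separately; that [p] is below neither [q] nor [r]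
    follows, as a join-irreducible has elements strictly below it. *)
Record minimal_pair p q r : Prop := MinimalPair {
  mp_jirr : join_irreducible p;
  mp_jirrl : join_irreducible q;
  mp_jirrr : join_irreducible r;
  mp_le : p <= q `|` r;
  mp_minl : forall y, p <= y `|` r -> ~~ (y < q);
  mp_minr : forall y, p <= q `|` y -> ~~ (y < r) }.

Lemma minimal_pairC p q r : minimal_pair p q r -> minimal_pair p r q.
Proof.
case=> pJ qJ rJ pqr minq minr; split=> //; first by rewrite joinC.
- by move=> y; rewrite joinC; exact: minr.
- by move=> y; rewrite joinC; exact: minq.
Qed.

Lemma jirr_ltP p : join_irreducible p -> exists y, y < p.
Proof.
case=> /existsNP[w /negP pw] _; exists (p `&` w).
by rewrite lt_neqAle leIl andbT; apply: contraNneq pw => <-; exact: leIr.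
Qed.

Lemma mp_nlel p q r : minimal_pair p q r -> ~~ (p <= q).
Proof.
move=> pqr; apply/negP => pq; have [y yr] := jirr_ltP (mp_jirrr pqr).
by have /negP := mp_minr pqr (y := y) (le_trans pq (leUl _ _)).
Qed.

Lemma mp_nler p q r : minimal_pair p q r -> ~~ (p <= r).
Proof. by move=> /minimal_pairC /mp_nlel. Qed.

Lemma mp_minlE p q r y : minimal_pair p q r -> y <= q -> p <= y `|` r -> y = q.
Proof.
move=> pqr yq /(mp_minl pqr); rewrite lt_neqAle yq andbT negbK.
by move/eqP.
Qed.

Lemma minimal_pair_D_rel p q r : minimal_pair p q r -> D_rel p q.
Proof.
move=> pqr; split.
  by move=> pq; move: (mp_nlel pqr); rewrite pq lexx.
exists r; split=> [|y]; first exact: mp_le pqr.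
by move=> yq; apply: contraL yq => /(mp_minl pqr).
Qed.

(** * Join-irreducible elements under the three identities *)

Hypotheses (KS : identity_S K) (KU : identity_U K) (KB : identity_B K).

(** The left side of (U) is [p] itself, so [p] equals one of the joinands on the right. (B) and (S)
    are exploited in the same way below. *)
Lemma jirr_U p x0 x1 x2 : join_irreducible p ->
  p <= x0 `|` x1 -> p <= x1 `|` x2 -> p <= x0 `|` x2 ->
  [\/ p <= x0, p <= x1 | p <= x2].
Proof.
move=> [_ pJ] p01 p12 p02; have := KU p x0 x1 x2.
rewrite (meet_l p01) (meet_l p12) (meet_l p02) => /pJ[/pJ[]|] ->.
- by apply: Or31; rewrite (le_trans (leIl _ _) (leIr _ _)).
- by apply: Or32; rewrite (le_trans (leIl _ _) (leIr _ _)).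
- by apply: Or33; rewrite (le_trans (leIl _ _) (leIr _ _)).
Qed.

Lemma jirr_B p a0 a1 b0 b1 : join_irreducible p ->
  p <= a0 `|` a1 -> p <= b0 `|` b1 ->
  [\/ p <= a0, p <= a1, p <= b0 | p <= b1] \/
  (p <= a0 `|` b0 /\ p <= a1 `|` b1 \/ p <= a0 `|` b1 /\ p <= a1 `|` b0).
Proof.
move=> [_ pJ] pa pb; have := KB p a0 a1 b0 b1.
rewrite /= (meet_l pa) (meet_l pb).
have le3 a b : p `&` a `&` b <= a by rewrite (le_trans (leIl _ _) (leIr _ _)).
move=> /pJ[/pJ[/pJ[]|/pJ[]]|/pJ[]] pE.
- by left; apply: Or41; rewrite pE le3.
- by left; apply: Or43; rewrite pE le3.
- by left; apply: Or42; rewrite pE le3.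
- by left; apply: Or44; rewrite pE le3.
- by right; left; split; rewrite pE ?le3 ?leIr.
- by right; right; split; rewrite pE ?le3 ?leIr.
Qed.

Lemma jirr_S p b b0 b1 c : join_irreducible p ->
  p <= b `|` c -> b <= b0 `|` b1 ->
  [\/ p <= b,
      p <= b0 `|` c /\ p <= (b `&` (p `|` b0)) `|` c |
      p <= b1 `|` c /\ p <= (b `&` (p `|` b1)) `|` c].
Proof.
move=> [_ pJ] pbc bb; have := KS p b b0 b1 c.
have le3 a e : p `&` a `&` e <= a by rewrite (le_trans (leIl _ _) (leIr _ _)).
rewrite /= (meet_l bb) (meet_l pbc) => /pJ[|/pJ[]] pE.
- by apply: Or31; rewrite pE leIr.
- by apply: Or32; split; rewrite {1}pE ?le3 ?leIr.
- by apply: Or33; split; rewrite {1}pE ?le3 ?leIr.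
Qed.

(* Dual 2-distributivity follows from (S). *)
Lemma jirr_join3 p u v y : join_irreducible p -> p <= u `|` v `|` y ->
  [\/ p <= u `|` v, p <= u `|` y | p <= v `|` y].
Proof.
move=> pJ puvy; have [->|[h _]|[h _]] := jirr_S pJ puvy (lexx _).
- exact: Or31.
- exact: Or32.
- exact: Or33.
Qed.

(** This is (U) on [q], [r], [s], where [p] is below neither [q] nor [r]. *)
Lemma mp_triangle p q r s : minimal_pair p q r -> p <= r `|` s -> p <= q `|` s ->
  p <= s.
Proof.
move=> pqr prs pqs; have npq := mp_nlel pqr; have npr := mp_nler pqr.
have [] := jirr_U (mp_jirr pqr) (mp_le pqr) prs pqs => //.
  by move=> pq; rewrite pq in npq.
by move=> pq; rewrite pq in npr.
Qed.

(** Otherwise (B), on the covers [y], [r] and [q], [q'] of [p], puts [p] below the join of [y] with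
    [q], which is [q], or with [q'], against the minimality of [q]. *)
Lemma mp_min_of_le p q q' r r' y : minimal_pair p q q' -> minimal_pair p r r' ->
  p <= q `|` r -> y < q -> ~~ (p <= y `|` r).
Proof.
move=> pq pr pqr yq; apply/negP => pyr.
have yqE : y `|` q = q by apply: join_r; exact: ltW.
have npq := negP (mp_nlel pq).
have npyq' : ~ p <= y `|` q' by move=> /(mp_minl pq); rewrite yq.
have [[py|pr'|pq'|pq']|[[p1 p2]|[p1 p2]]] :=
  jirr_B (mp_jirr pq) pyr (mp_le pq).
- by apply: npyq'; rewrite (le_trans py) // leUl.
- by have := mp_nlel pr; rewrite pr'.
- by [].
- by have := mp_nler pq; rewrite pq'.
- by move: p1; rewrite yqE.
- by [].
Qed.

Lemma minimal_pair_of_le p q q' r r' : minimal_pair p q q' ->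
  minimal_pair p r r' -> p <= q `|` r -> minimal_pair p q r.
Proof.
move=> pq pr pqr; split=> //.
- exact: mp_jirr pq.
- exact: mp_jirrl pq.
- exact: mp_jirrl pr.
- by move=> y pyr; apply/negP => /(mp_min_of_le pq pr pqr); rewrite pyr.
- move=> y pyr; apply/negP => yr; rewrite joinC in pqr.
  by have := mp_min_of_le pr pq pqr yr; rewrite joinC pyr.
Qed.

(** By (B) on the two covers of [p], each vertex of the graph of minimal pairs is adjacent to an end
    of every edge. *)
Lemma minimal_pair_or p q q' r r' : minimal_pair p q q' -> minimal_pair p r r' ->
  minimal_pair p q r \/ minimal_pair p q r'.
Proof.
move=> pq pr.
have [[pq'|pq'|pr'|pr']|[[p1 p2]|[p1 p2]]] :=
  jirr_B (mp_jirr pq) (mp_le pq) (mp_le pr).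
- by have := mp_nlel pq; rewrite pq'.
- by have := mp_nler pq; rewrite pq'.
- by have := mp_nlel pr; rewrite pr'.
- by have := mp_nler pr; rewrite pr'.
- by left; exact: minimal_pair_of_le pq pr p1.
- by right; exact: minimal_pair_of_le pq (minimal_pairC pr) p1.
Qed.

(* [x] separates the two sides of the bipartite graph of minimal pairs of [p]. *)
Definition separates x p :=
  forall q r, minimal_pair p q r -> (p <= x `|` q) = ~~ (p <= x `|` r).

Lemma separates_mp p x x' : minimal_pair p x x' -> separates x p.
Proof.
move=> px q r pqr; apply/idP/idP => [pxq|].
  apply/negP => pxr; have := mp_triangle pqr (s := x).
  rewrite (joinC r) pxr (joinC q) pxq => /(_ isT isT) p_le.
  by have := mp_nlel px; rewrite p_le.
by have [/mp_le|/mp_le ->] := minimal_pair_or px pqr.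
Qed.

(** Were [q] adjacent to [r'] instead, [q] and [r] would both be opposite to [r'], hence on the same
    side. *)
Lemma separates_minimal_pair p x q q' r r' : separates x p ->
  minimal_pair p q q' -> minimal_pair p r r' ->
  p <= x `|` q -> ~~ (p <= x `|` r) -> minimal_pair p q r.
Proof.
move=> sep pq pr pxq pxr; have [//|pqr'] := minimal_pair_or pq pr.
by move: pxr; rewrite (sep _ _ pr) (sep _ _ (minimal_pairC pqr')) pxq.
Qed.

(** In (S) the element [p] is replaced by its meet with the join of [o] and [u] (or [v]); minimality
    of [p] makes this meet equal to [p]. *)
Lemma mp_S o p x u v : minimal_pair o p x -> p <= u `|` v ->
  (o <= u `|` x /\ p <= o `|` u) \/ (o <= v `|` x /\ p <= o `|` v).
Proof.
move=> opx puv.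
have aux w : o <= (p `&` (o `|` w)) `|` x -> p <= o `|` w.
  by move=> /(mp_minlE opx (leIl _ _)) <-; exact: leIr.
have [op|[h1 /aux h2]|[h1 /aux h2]] := jirr_S (mp_jirr opx) (mp_le opx) puv.
- by have := mp_nlel opx; rewrite op.
- by left.
- by right.
Qed.

Lemma mp_nle o p x : minimal_pair o p x -> ~~ (p <= x).
Proof.
move=> opx; apply: contra (mp_nler opx) => px.
by rewrite (le_trans (mp_le opx)) // leUx px lexx.
Qed.

(** By (U), [x] cannot cover [p] with both [q] and [r]; by (S), transported from [o], it does so
    with at least one of them. *)
Lemma separates_child o p x : minimal_pair o p x -> separates x p.
Proof.
move=> opx q r pqr; apply/idP/idP => [pxq|].
  apply/negP => pxr; have := mp_triangle pqr (s := x).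
  rewrite (joinC r) pxr (joinC q) pxq => /(_ isT isT) p_le.
  by have := mp_nle opx; rewrite p_le.
apply: contraR => pxq.
have pstep w : o <= w `|` x -> p <= o `|` w -> p <= x `|` w.
  move=> ow pw; rewrite (le_trans pw) // leUx leUr andbT.
  by rewrite joinC.
have [[h1 h2]|[h1 h2]] := mp_S opx (mp_le pqr); last exact: pstep.
by rewrite pstep in pxq.
Qed.

(** If [x] and [x'] disagreed on [q], (B) would put [p], hence [o], below the join of [x] and [x'];
    with the pairs of [p] with [x] and [x'], (U) then gives [o <= x']. *)
Lemma separates_indep o p x x' q q' :
  minimal_pair o p x -> minimal_pair o p x' -> minimal_pair p q q' ->
  p <= x `|` q -> p <= x' `|` q.
Proof.
move=> ox ox' pq pxq; apply: contraT => nx'q.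
have : p <= x' `|` q' by rewrite (separates_child ox' (minimal_pairC pq)).
have nxq' : ~~ (p <= x `|` q') by rewrite -(separates_child ox pq).
move=> px'q'; have pxx' : p <= x `|` x'.
  have [[px|pq_|px|pq_]|[[p1 p2]|[p1 p2]]] :=
    jirr_B (mp_jirr pq) pxq px'q' => //.
  - by have := mp_nle ox; rewrite px.
  - by have := mp_nlel pq; rewrite pq_.
  - by have := mp_nle ox'; rewrite px.
  - by have := mp_nler pq; rewrite pq_.
  - by rewrite p1 in nxq'.
have := mp_triangle ox (s := x').
have -> : o <= x `|` x'.
  by rewrite (le_trans (mp_le ox)) // leUx pxx' leUl.
rewrite (mp_le ox') => /(_ isT isT) ole.
by have := mp_nler ox'; rewrite ole.
Qed.

(** This holds by finiteness in a finite lattice and by Zorn's lemma for filters. *)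
Hypothesis minimal_join : forall p x y, p <= x `|` y ->
  exists x', [/\ x' <= x, p <= x' `|` y & forall z, p <= z `|` y -> ~~ (z < x')].

Lemma minimal_pair_exists p x y : join_irreducible p ->
  p <= x `|` y -> ~~ (p <= x) -> ~~ (p <= y) ->
  exists q r, [/\ q <= x, r <= y & minimal_pair p q r].
Proof.
move=> pJ pxy npx npy.
(* A minimal [u] is join-irreducible: if [u] is a join, [jirr_join3] lets one joinand replace it. *)
have aux u v z : p <= u `|` z -> ~~ (p <= u) -> ~~ (p <= z) ->
    (forall w, p <= w `|` z -> ~~ (w < u)) -> join_irreducible u.
  move=> puz npu npz umin; split=> [ubot|a b uab].
    by move/negP: npz; apply; rewrite (le_trans puz) // leUx ubot lexx.
  have leu w : w <= u -> p <= w `|` z -> u = w.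
    by move=> wu /umin; rewrite lt_neqAle wu andbT negbK => /eqP.
  rewrite uab in puz; have [pab|paz|pbz] := jirr_join3 pJ puz.
  - by rewrite uab pab in npu.
  - by left; apply: leu => //; rewrite uab leUl.
  - by right; apply: leu => //; rewrite uab leUr.
(* After [x] is shrunk to [q], shrinking [y] to [r] keeps [q] minimal because [r <= y]. *)
have [q [qx pqy qmin]] := minimal_join pxy.
have [|r [ry prq rmin]] := @minimal_join p y q; first by rewrite joinC.
have npq : ~~ (p <= q) by apply: contra npx => pq; exact: le_trans qx.
have npr : ~~ (p <= r) by apply: contra npy => pr; exact: le_trans ry.
exists q, r; split=> //; split=> //.
- exact: aux pqy _ _ qmin.
- exact: aux prq _ _ rmin.
- by rewrite joinC.
- move=> z pzr; apply: qmin; apply: (le_trans pzr).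
  by rewrite leUx leUl (le_trans ry) ?leUr.
- by move=> z; rewrite joinC; exact: rmin.
Qed.

End MinimalPairs.

(** * The oriented tree *)

Section ListTree.
Context (T : eqType).
Implicit Types (a x y : seq T) (s t : seq (seq T)).

(* The tree of all lists over [T], the parent of a list being its tail. *)
Definition tree_adj x y := (x == behead y) || (y == behead x).

Lemma suffix_consE a q x : suffix a (q :: x) = (a == q :: x) || suffix a x.
Proof.
apply/idP/orP => [/suffixP[[|t s']]|[/eqP ->|ax]].
- by move=> ->; left.
- by move=> [_ ->]; right; exact: suffix_suffix.
- exact: suffix_refl.
- exact: suffix_trans ax (suffix_cons x q).
Qed.

(** The subtree of [q :: a] can be left only through [a]. *)
Lemma path_in_subtree q a x s : path tree_adj x s -> a \notin s ->
  suffix (q :: a) x -> suffix (q :: a) (last x s).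
Proof.
elim: s x => //= y s IHs x /andP[xy xs]; rewrite inE negb_or => /andP[ay as_] qx.
apply: IHs => //; case/orP: xy => /eqP xy.
  case: y ay xy {xs} => [|t y'] _ /= xy; first by rewrite xy in qx.
  by rewrite suffix_consE -xy qx orbT.
case: x qx xy => [|t x'] /= qx xy; first by rewrite xy.
rewrite xy in ay *.
move: qx; rewrite suffix_consE => /orP[/eqP[_ ax']|//].
by rewrite ax' eqxx in ay.
Qed.

(** The subtree of [a] can be entered only at [a]. *)
Lemma path_out_subtree a x s : path tree_adj x s -> a \notin s ->
  ~~ suffix a x -> ~~ suffix a (last x s).
Proof.
elim: s x => //= y s IHs x /andP[xy xs]; rewrite inE negb_or => /andP[ay as_] qx.
apply: IHs => //; case/orP: xy => /eqP xy.
  case: y ay xy {xs} => [|t y'] ay /= xy; first by rewrite xy in qx.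
  by rewrite suffix_consE negb_or ay -xy.
case: x qx xy => [|t x'] qx xy; rewrite xy //=.
by move: qx; rewrite suffix_consE negb_or => /andP[].
Qed.

Lemma tree_adjP x y : x != y -> tree_adj x y ->
  (exists q, y = q :: x) \/ (y = behead x /\ ~~ suffix x y).
Proof.
move=> nxy /orP[/eqP xy|/eqP yx].
  case: y xy nxy => [|q y] /= -> //; rewrite ?eqxx // => _; left; by exists q.
case: x yx nxy => [|q x] /= -> //; rewrite ?eqxx // => _; right; split=> //.
by apply/negP => /size_suffix /=; rewrite ltnn.
Qed.

(** Different first steps lead into different components of the tree without [x], and [x] is never
    revisited. *)
Lemma tree_path_uniq x s t : path tree_adj x s -> path tree_adj x t ->
  uniq (x :: s) -> uniq (x :: t) -> last x s = last x t -> s = t.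
Proof.
elim: s x t => [|y s IHs] x [|z t] //=.
- by move=> _ _ _ /andP[/negP xzt _] xl; case: xzt; rewrite xl mem_last.
- by move=> _ _ /andP[/negP xys _] _ xl; case: xys; rewrite -xl mem_last.
move=> /andP[xy ys] /andP[xz zt] /andP[]; rewrite inE negb_or.
move=> /andP[nxy xs] us /andP[]; rewrite inE negb_or => /andP[nxz xt] ut lst.
have [yz|nyz] := eqVneq y z; first by rewrite yz in ys lst us *; rewrite (IHs z t).
have child_other q u v s' t' : u = q :: x -> ~~ suffix x v -> path tree_adj u s' ->
    path tree_adj v t' -> x \notin s' -> x \notin t' -> last u s' != last v t'.
  move=> uE xv us' vt' xs' xt'; apply: contraNneq (path_out_subtree vt' xt' xv) => <-.
  apply: (suffix_trans (suffix_cons x q)).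
  apply: (path_in_subtree us') => //; by rewrite uE suffix_refl.
case: (tree_adjP nxy xy) (tree_adjP nxz xz) => [[q yE]|[yE nxsy]] [[r zE]|[zE nxsz]].
- have qs : suffix (q :: x) (last z t).
    by rewrite -lst; apply: (path_in_subtree ys) => //; rewrite yE suffix_refl.
  have rs : suffix (r :: x) (last z t).
    by apply: (path_in_subtree zt) => //; rewrite zE suffix_refl.
  have : q :: x = r :: x.
    by move: qs rs; rewrite !suffixE => /eqP <- /eqP <-.
  by move=> /eqP; rewrite -yE -zE (negPf nyz).
- by have := child_other _ _ _ _ _ yE nxsz ys zt xs xt; rewrite lst eqxx.
- by have := child_other _ _ _ _ _ zE nxsy zt ys xt xs; rewrite lst eqxx.
- by rewrite yE zE eqxx in nyz.
Qed.

End ListTree.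

(** * The poset of nodes *)

Section OrientedTree.
Context (d : Order.disp_t) (K : latticeType d).
Implicit Types (p q r : K) (a b c s : seq K).

(** The empty list is excluded, so the nodes form a forest with one root for each
    join-irreducible. *)
Fixpoint is_node s : Prop :=
  if s is p :: s' then
    if s' is o :: _ then (exists x, minimal_pair o p x) /\ is_node s'
    else join_irreducible p
  else False.

(* The element deciding on which side of [p :: s] each child of [p :: s] lies;
   at a root, the choice of the side is arbitrary. *)
Definition ref p s : K :=
  xget p (if s is o :: _ then [set x | minimal_pair o p x]
          else [set x | exists x', minimal_pair p x x']).

(* [up (p :: s)] tells whether [p :: s] is above its parent [s]. *)
Fixpoint up s : bool :=
  if s is q :: s' then
    if s' is p :: s'' then up s' (+) ~~ (p <= ref p s'' `|` q) else true
  else true.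

Definition edge a b : bool :=
  (behead b == a) && up b || (behead a == b) && ~~ up a.

(** A grading: each edge raises it by one, so that [tree_le] is antisymmetric and edges are exactly
    the coverings. *)
Fixpoint height s : int :=
  if s is _ :: s' then (height s' + (if up s then 1 else -1))%R else 0%R.

Record tree := TreeNode {
  tree_seq :> seq K;
  tree_seqP : `[< is_node tree_seq >] }.

HB.instance Definition _ := [isSub for tree_seq].
HB.instance Definition _ := [Choice of tree by <:].

Implicit Types (g h k : tree).

Lemma treeP g : is_node g.
Proof. exact/asboolP/tree_seqP. Qed.

Lemma edge_height g h : edge g h -> height h = (height g + 1)%R.
Proof.
have := treeP g; have := treeP h; rewrite /edge.
case: (val g) => [|p s] //; case: (val h) => [|q t] // _ _ /=.
case/orP=> /andP[/eqP].
  by case: t => [|o t] // [-> ->] upq; rewrite -/(height (q :: p :: s)) /= upq.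
by case: s => [|o s] // [-> ->] upp; rewrite /= (negPf upp); lia.
Qed.

Definition tree_le g h : bool :=
  `[< exists s : seq tree, path (edge : rel tree) g s /\ last g s = h >].

Lemma walk_height g (s : seq tree) : path (edge : rel tree) g s ->
  height (last g s) = (height g + (size s)%:Z)%R.
Proof.
elim: s g => [|h s IHs] g /=; first by lia.
by move=> /andP[/edge_height gh /IHs ->]; lia.
Qed.

Lemma tree_le_refl : reflexive tree_le.
Proof. by move=> g; apply/asboolP; exists [::]. Qed.

Lemma tree_le_trans : transitive tree_le.
Proof.
move=> h g k /asboolP[s [gs hE]] /asboolP[t [ht kE]]; apply/asboolP.
by exists (s ++ t); rewrite cat_path last_cat hE gs.
Qed.

Lemma tree_le_anti : antisymmetric tree_le.
Proof.
move=> g h /andP[/asboolP[s [gs hE]] /asboolP[t [ht gE]]].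
have := walk_height gs; have := walk_height ht; rewrite hE gE => h1 h2.
by case: s gs hE h2 => [|k s] //= _ _; lia.
Qed.

Fact tree_display : Order.disp_t. Proof. exact: Order.Disp tt tt. Qed.

HB.instance Definition _ := Order.Le_isPOrder.Build tree_display tree
  tree_le_refl tree_le_anti tree_le_trans.

Lemma tree_leP g h :
  reflect (exists s : seq tree, path (edge : rel tree) g s /\ last g s = h) (g <= h).
Proof. exact: asboolP. Qed.

Lemma edge_le g h : edge g h -> g <= h.
Proof. by move=> gh; apply/tree_leP; exists [:: h]; rewrite /= gh. Qed.

Lemma tree_lt_height g h : g < h -> (height g < height h)%R.
Proof.
rewrite lt_neqAle => /andP[ngh /tree_leP[[|k s] [/= gs hE]]].
  by rewrite hE eqxx in ngh.
by have /= := walk_height (s := k :: s) gs; rewrite hE; lia.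
Qed.

Lemma edge_pred_rel g h : pred_rel g h = edge g h.
Proof.
apply/andP/idP => [[gh /asboolPn ngh]|gh].
  have := gh; rewrite lt_neqAle => /andP[nEgh /tree_leP[[|k s]] [/= gs hE]].
    by rewrite hE eqxx in nEgh.
  move: gs => /andP[gk ks]; case: s => [|k' s] in ks hE *; first by rewrite -hE.
  have kh : k <= h by apply/tree_leP; exists (k' :: s).
  case: ngh; exists k; apply/andP; split; rewrite lt_neqAle.
    rewrite (edge_le gk) andbT; apply/eqP => E.
    by have := edge_height gk; rewrite E; lia.
  rewrite kh andbT; apply/eqP => E.
  by have := walk_height ks; rewrite hE -E /=; lia.
have hgt := edge_height gh; split.
  rewrite lt_neqAle (edge_le gh) andbT; apply/eqP => E.
  by rewrite E in hgt; lia.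
apply/asboolPn => -[k /andP[/tree_lt_height gk /tree_lt_height kh]]; lia.
Qed.

Lemma tree_tree_like : tree_like tree.
Proof.
split=> [g h /tree_leP[s [gs hE]]|g h s t].
  by exists s; rewrite (eq_path edge_pred_rel).
have adj (u v : tree) : pred_rel u v || pred_rel v u -> tree_adj (val u) (val v).
  rewrite !edge_pred_rel /edge /tree_adj.
  by do 2![case/orP] => /andP[/eqP -> _]; rewrite eqxx ?orbT.
move=> /and3P[/(sub_path adj) gs us /eqP hs] /and3P[/(sub_path adj) gt ut /eqP ht].
apply: (inj_map val_inj); apply: (tree_path_uniq (x := val g)).
- by rewrite path_map.
- by rewrite path_map.
- by rewrite -map_cons map_inj_uniq //; exact: val_inj.
- by rewrite -map_cons map_inj_uniq //; exact: val_inj.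
- by rewrite !last_map hs ht.
Qed.

(** Here [b] is a descendant of [a], and each step away from the root goes up in the order if [e] is
    true, down if it is false. *)
Inductive desc (e : bool) : seq K -> seq K -> Prop :=
| desc_refl a : desc e a a
| desc_step q a b : up (q :: a) = e -> desc e (q :: a) b -> desc e a b.

Lemma desc_rcons e q a b : desc e a b -> up (q :: b) = e -> desc e a (q :: b).
Proof.
elim=> [c|r a' b' upr _ IH] upq; first exact: desc_step upq (desc_refl _ _).
exact: desc_step upr (IH upq).
Qed.

Lemma desc_consP e q a b : desc e a (q :: b) ->
  a = q :: b \/ up (q :: b) = e /\ desc e a b.
Proof.
move E: (q :: b) => c ab; elim: ab E => [a' <-|r a' c' upr _ IH E]; first by left.
case: (IH E) => [aE|[upq ab]]; right; last by split=> //; exact: desc_step ab.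
by move: aE upr; rewrite -E => -[-> ->] upr; split=> //; exact: desc_refl.
Qed.

Lemma desc_trans e a b c : desc e a b -> desc e b c -> desc e a c.
Proof. by elim=> // q a' b' upq _ IH bc; exact: desc_step upq (IH bc). Qed.

Lemma is_node_behead p q s : is_node (q :: p :: s) -> is_node (p :: s).
Proof. by case. Qed.

Lemma is_node_jirr (p : K) s : is_node (p :: s) -> join_irreducible p.
Proof. by case: s => [|o s] // [[x /mp_jirrl]]. Qed.

Lemma desc_node e p s b : desc e (p :: s) b -> is_node b -> is_node (p :: s).
Proof.
move E: (p :: s) => a ab; elim: ab p s E => // q a' b' _ _ IH p s E b'n.
by have := IH q a' erefl b'n; rewrite -E => /is_node_behead.
Qed.

(** An increasing walk goes first towards a root and then away from it: a child entered from its
    parent lies above it, so the walk cannot go back. *)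
Lemma walk_desc g (s : seq tree) : path (edge : rel tree) g s ->
  exists2 c : tree, desc false c g & desc true c (last g s).
Proof.
elim: s g => [|h s IHs] g /=; first by move=> _; exists g; exact: desc_refl.
move=> /andP[gh /IHs[c ch cl]].
case/orP: gh => /andP[/eqP gh upgh]; last first.
  exists c => //; move: upgh (treeP g) ch; rewrite -gh.
  case: (val g) => [|p t] //.
  move=> /negPf upg _ cht.
  exact: desc_rcons.
move: upgh (treeP h) ch cl gh; case: (val h) => [|q t] // upq _ ch cl /= tg.
(* As [h] is above its parent, no nontrivial downward branch ends in it, and [c] is [h]. *)
have [cE|[]] := desc_consP ch; last by rewrite upq.
rewrite cE in cl; exists g; first exact: desc_refl.
by rewrite -tg; exact: desc_step upq cl.
Qed.

(** * Inequalities along monotone paths *)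

Hypotheses (KS : identity_S K) (KU : identity_U K) (KB : identity_B K).

Lemma ref_minimal_pair p q s : is_node (q :: p :: s) ->
  minimal_pair p q (ref q (p :: s)).
Proof. by move=> [qn _]; exact: (xgetPex _ qn). Qed.

Lemma separates_ref p s : is_node (p :: s) -> separates (ref p s) p.
Proof.
case: s => [|o s] ps; last exact: (separates_child KS KU (ref_minimal_pair ps)).
(* At a root without minimal pairs the default value is harmless: there is nothing to separate. *)
rewrite /ref; case: xgetP => [x _ [x' /(separates_mp KU KB)] //|nx].
by move=> q r pqr; case: (nx q); exists r.
Qed.

Lemma up_consE q p s : up (q :: p :: s) = up (p :: s) (+) ~~ (p <= ref p s `|` q).
Proof. by []. Qed.

Lemma up_neq p q r s : is_node (p :: s) -> minimal_pair p q r ->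
  up (q :: p :: s) != up (r :: p :: s).
Proof.
move=> /separates_ref ps /ps psqr; rewrite !up_consE psqr negbK.
by case: (up (p :: s)); case: (_ <= _).
Qed.

Lemma minimal_pair_up p q r s : is_node (q :: p :: s) -> is_node (r :: p :: s) ->
  up (q :: p :: s) != up (r :: p :: s) -> minimal_pair p q r.
Proof.
move=> [[q' pq] ps] [[r' pr] _]; have sep := separates_ref ps.
rewrite !up_consE; have [pq_|npq] := boolP (p <= _ `|` q);
  have [pr_|npr] := boolP (p <= _ `|` r); rewrite /= ?eqxx // => _.
  exact: (separates_minimal_pair KB sep pq pr).
exact/minimal_pairC/(separates_minimal_pair KB sep pr pq).
Qed.

(** Induction along the branch: the covers of [p1] given by the next node [q] are carried to [p0] by
    (S). The partner [x] has to be arbitrary for the induction. *)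
Lemma desc_le e a b p0 p1 s pn t x : desc e a b -> a = p1 :: p0 :: s ->
  b = pn :: t -> is_node b -> up a = e -> minimal_pair p0 p1 x ->
  [/\ p0 <= x `|` pn, p1 <= x `|` pn & p1 <= p0 `|` pn].
Proof.
move=> ab; elim: ab p0 p1 s x => [c|q a' b' upq ab IH] p0 p1 s x aE bE bn upa px.
  move: bE; rewrite aE => -[<- _]; split; rewrite ?leUr //.
  by rewrite joinC; exact: mp_le px.
rewrite aE in IH ab upa upq.
have qn : is_node (q :: p1 :: p0 :: s) := desc_node ab bn.
have pn1 := is_node_behead qn.
have [[x2 px2] _] := qn.
have [p1x2 _ _] := IH _ _ _ _ erefl bE bn upq px2.
(* The direction does not change at [q], so the reference partner covers [p1] with [q], and hence
   every partner does. *)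
have p1xq : p1 <= x `|` q.
  apply: (separates_indep KS KU KB (ref_minimal_pair pn1) px px2).
  by move: upq; rewrite up_consE upa; case: (_ <= _); case: (e).
have [[h1 h2]|[h1 h2]] := mp_S KS px p1x2; last first.
  split=> //; first by rewrite joinC.
  by rewrite (le_trans h2) // leUx leUr joinC h1.
(* The other outcome of (S) is impossible: [x] would cover [p1] with both [q] and its partner
   [x2]. *)
have p1xx2 : p1 <= x `|` x2 by rewrite (le_trans h2) // leUx leUr joinC h1.
have := mp_triangle KU px2 (s := x).
rewrite (joinC x2) p1xx2 (joinC q) p1xq => /(_ isT isT) p1x.
by have := mp_nle px; rewrite p1x.
Qed.

Lemma desc_between e p s q t r w : desc e (p :: s) (q :: t) ->
  desc e (q :: t) (r :: w) -> is_node (r :: w) -> q <= p `|` r.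
Proof.
move E: (p :: s) => a; move F: (q :: t) => b ab.
elim: ab p s E q t F => [a' p s <- q t [-> _] _ _|]; first exact: leUl.
move=> q1 a' b' upq ab IH p s aE q t bE br rn; rewrite -aE in IH ab upq.
have ar := desc_trans ab br; have qn := desc_node ar rn.
have [[x px] _] := qn.
have [_ _ q1le] := desc_le ar erefl erefl rn upq px.
by rewrite (le_trans (IH _ _ erefl _ _ bE br rn)) // leUx q1le leUr.
Qed.

(** The first nodes [q1] and [r1] of the branches form a minimal pair of [p]. By [desc_le] each may
    be replaced by the end of its branch; (B) combines the two replacements, and (U) settles the
    crossed case. *)
Lemma desc_fork p s q t r w : desc false (p :: s) (q :: t) ->
  desc true (p :: s) (r :: w) -> is_node (q :: t) -> is_node (r :: w) ->
  p <= q `|` r.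
Proof.
move E: (p :: s) => a pq; move F: (q :: t) => b in pq *.
case: pq E F => [a' <- [-> _] _ _ _|q1 a' b' upq aq aE bE]; first exact: leUl.
rewrite -bE -aE in aq upq * => {a a' b b' aE bE}.
move G: (p :: s) => a; move H: (r :: w) => b ac.
case: ac G H => [a' <- [-> _] _ _|r1 a' b' upr ar aE bE]; first exact: leUr.
rewrite -bE -aE in ar upr * => {a' b' aE bE} qn rn.
have q1n := desc_node aq qn; have r1n := desc_node ar rn.
have pqr : minimal_pair p q1 r1 by apply: minimal_pair_up q1n r1n _; rewrite upq upr.
have prq := minimal_pairC pqr.
have [pr1q _ _] := desc_le aq erefl erefl qn upq pqr.
have [pq1r _ _] := desc_le ar erefl erefl rn upr prq.
have [[pr1|pq|pq1|pr]|[[h1 h2]|[h1 h2]]] := jirr_B KB (mp_jirr pqr) pr1q pq1r.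
- by have := mp_nler pqr; rewrite pr1.
- by rewrite (le_trans pq) ?leUl.
- by have := mp_nlel pqr; rewrite pq1.
- by rewrite (le_trans pr) ?leUr.
- by [].
have := mp_triangle KU pqr pr1q; rewrite (joinC q1) h2 => /(_ isT) pq.
by rewrite (le_trans pq) ?leUl.
Qed.

Lemma tree_between g h k p s q t r w : g <= h -> h <= k ->
  val g = p :: s -> val h = q :: t -> val k = r :: w -> q <= p `|` r.
Proof.
move=> /tree_leP[u [/walk_desc[c1 c1g c1h] uE]].
move=> /tree_leP[v [/walk_desc[c2 c2h c2k] vE]] gE hE kE.
rewrite uE in c1h; rewrite vE in c2k.
have gn := treeP g; have hn := treeP h; have kn := treeP k.
rewrite gE in gn c1g; rewrite hE in hn c1h c2h; rewrite kE in kn c2k.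
(* The middle node is on the branch from [o] to [x], and [y] ends the other branch: [q] is below the
   join of [o] and [x], and [o] below that of [x] and [y]. *)
have fork e o c x a y b : desc e (o :: c) (q :: t) ->
    desc e (q :: t) (x :: a) -> desc (~~ e) (o :: c) (y :: b) ->
    is_node (x :: a) -> is_node (y :: b) -> q <= x `|` y.
  move=> oq qx oy xn yn; apply: (le_trans (desc_between oq qx xn)).
  rewrite leUx leUl andbT; have ox := desc_trans oq qx.
  case: e oq qx oy ox => oq qx oy ox;
    [rewrite joinC; exact: desc_fork oy ox yn xn|exact: desc_fork ox oy xn yn].
have := treeP c1; have := treeP c2.
case: (val c1) c1g c1h => [|o1 u1] // c1g c1h.
case: (val c2) c2h c2k => [|o2 u2] // c2h c2k _ _.
(* The middle node is not both above and below its parent, so one of the two walks has its turning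
   point there. *)
have [c1E|[upq _]] := desc_consP c1h.
  by rewrite c1E in c1g; exact: fork c2h c1g c2k gn kn.
have [c2E|[]] := desc_consP c2h; last by rewrite upq.
by rewrite c2E in c2k; rewrite joinC; exact: fork c1h c2k c1g kn gn.
Qed.

End OrientedTree.

(** * The representation *)

Definition minimal_joins (d : Order.disp_t) (K : latticeType d) :=
  forall p x y : K, p <= x `|` y ->
    exists x', [/\ x' <= x, p <= x' `|` y & forall z, p <= z `|` y -> ~~ (z < x')].

Section Representation.
Context (d : Order.disp_t) (K : latticeType d).
Hypotheses (KS : identity_S K) (KU : identity_U K) (KB : identity_B K).
Hypothesis Kmin : minimal_joins K.
Implicit Types (x y : K) (g h k : tree K).

Definition heads_below x : set (tree K) :=
  [set g | if val g is p :: _ then p <= x else false].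

Lemma heads_below_mono x y : x <= y -> heads_below x `<=` heads_below y.
Proof.
by move=> xy g; rewrite /heads_below /=; case: (val g) => // p _ /le_trans; apply.
Qed.

Lemma heads_below_convex x : `[< order_convex (heads_below x) >].
Proof.
apply/asboolP => g k h; rewrite /heads_below /=.
case gE: (val g) => [|p s] //; case kE: (val k) => [|r w] // px rx gh hk.
have := treeP h; case hE: (val h) => [|q t] // _.
by rewrite (le_trans (tree_between KS KU KB gh hk gE hE kE)) // leUx px.
Qed.

Definition rep x : Co (tree K) := MkCo (heads_below_convex x).

Lemma repI x y : rep (x `&` y) = rep x `&` rep y.
Proof.
apply: val_inj; apply/seteqP; split=> g; rewrite /= /heads_below /setI /=.
  by case: (val g) => [|p s] //; rewrite lexI => /andP.
by case: (val g) => [|p s] [] //; rewrite lexI => -> ->.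
Qed.

Lemma is_node_cons (p q r : K) s : is_node (p :: s) -> minimal_pair p q r ->
  `[< is_node (q :: p :: s) >].
Proof. by move=> ps pqr; apply/asboolP; split=> //; exists r. Qed.

Lemma repU x y : rep (x `|` y) = rep x `|` rep y.
Proof.
apply/le_anti/andP; split; last first.
  by rewrite leUx; apply/andP; split; apply/Co_leP; apply: heads_below_mono;
    rewrite ?leUl ?leUr.
apply/Co_leP => g gxy; have ps := treeP g.
have {gxy}pxy : heads_below (x `|` y) g := gxy; rewrite /heads_below /= in pxy.
case gE: (val g) ps pxy => [|p s] // ps pxy.
have [px|npx] := boolP (p <= x).
  by apply: Co_in_joinl; rewrite /= /heads_below /= gE.
have [py|npy] := boolP (p <= y).
  by apply: Co_in_joinr; rewrite /= /heads_below /= gE.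
have pJ := is_node_jirr ps.
have [q [r [qx ry pqr]]] := minimal_pair_exists KS Kmin pJ pxy npx npy.
have prq := minimal_pairC pqr.
pose gq := TreeNode (is_node_cons ps pqr); pose gr := TreeNode (is_node_cons ps prq).
have qr := up_neq KS KU KB ps pqr.
have qP : Co_set (rep x) gq by [].
have rP : Co_set (rep y) gr by [].
have {}gE : tree_seq g = p :: s := gE.
have edge_up (h : tree K) z : tree_seq h = z :: p :: s -> up h -> g <= h.
  by move=> hE uph; apply: edge_le; rewrite /edge uph gE hE eqxx.
have edge_dn (h : tree K) z : tree_seq h = z :: p :: s -> ~~ up h -> h <= g.
  by move=> hE uph; apply: edge_le; rewrite /edge uph gE hE eqxx orbT.
(* One child is above [g] and the other below it, so [g] is in the hull. *)
case upq : (up (q :: p :: s)) qr => qr.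
  exists gr, gq; split; [by right|by left| |].
    by apply: edge_dn => //; apply: contra qr => /= ->.
  exact: (edge_up gq q erefl upq).
exists gq, gr; split; [by left|by right| |].
  by apply: edge_dn => //; rewrite upq.
apply: (edge_up gr r) => //.
by move: qr; rewrite [tree_seq gr]/=; case: (up (r :: p :: s)).
Qed.

(** The map [i] will be the identity for finite [L], and [principal] otherwise. *)
Context (d' : Order.disp_t) (L : latticeType d') (i : L -> K).
Hypotheses (iI : Order.meet_morphism i) (iU : Order.join_morphism i).
Hypothesis ibot : forall z : L, (forall x : L, z <= x) -> forall y, i z <= y.
Hypothesis itop : forall z : L, (forall x : L, x <= z) -> forall y, y <= i z.
Hypothesis isep : forall x y : L, ~~ (x <= y) ->
  exists p, [/\ join_irreducible p, p <= i x & ~~ (p <= i y)].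

Lemma representation : exists f : {lmorphism L -> Co (tree K)},
  injective f /\ preserves_existing_bounds f.
Proof.
pose f (x : L) := rep (i x).
have fI : Order.meet_morphism f by move=> x y; rewrite /f iI repI.
have fU : Order.join_morphism f by move=> x y; rewrite /f iU repU.
have fle : {homo f : x y / x <= y}.
  by move=> x y; rewrite !leEmeet -fI => /eqP ->.
pose F : {lmorphism L -> Co (tree K)} :=
  HB.pack f (Order.isOrderMorphism.Build _ _ _ _ f fle)
    (Order.isMeetLatticeMorphism.Build _ _ _ _ f fI)
    (Order.isJoinLatticeMorphism.Build _ _ _ _ f fU).
have f_le (x y : L) : Co_set (f x) `<=` Co_set (f y) -> x <= y.
  move=> xy; apply: contraT => /isep[p [pJ px /negP]]; case.
  have pn : `[< is_node [:: p] >] by exact/asboolP.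
  exact: (xy (TreeNode pn)).
exists F; split.
  move=> x y fxy; have {}fxy : f x = f y := fxy.
  by apply/le_anti/andP; split; apply: f_le; rewrite fxy.
split=> z zP; apply/seteqP; split=> // g /=; have := treeP g; rewrite /heads_below /=.
  case: (val g) => [|p s] // ps pz.
  have [+ _] := is_node_jirr ps.
  by case=> x; rewrite (le_trans pz) ?ibot.
by case: (val g) => [|p s] // _ _; exact: itop.
Qed.

End Representation.

(** * Finiteness of the tree without [D]-cycles *)

Section FiniteTree.
Context (d : Order.disp_t) (K : latticeType d).

(** Each entry is [D]-related to the next one chosen; nodes store the latest entry first, hence the
    reversal. *)
Lemma is_node_D_path (p q : K) s t : is_node (q :: s ++ p :: t) ->
  path (fun p q => `[< D_rel p q >]) p (rcons (rev s) q) /\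
  {in p :: s, forall r, join_irreducible r}.
Proof.
elim: s q => [|r s IH] q [[x rq] rn].
  split; first by rewrite /= andbT; exact/asboolP/(minimal_pair_D_rel rq).
  by move=> r; rewrite inE => /eqP ->; exact: mp_jirr rq.
have [ps sJ] := IH r rn; split.
  by rewrite rev_cons rcons_path ps last_rcons; exact/asboolP/(minimal_pair_D_rel rq).
move=> u; rewrite !inE => /or3P[/eqP ->|/eqP ->|us].
- by apply: sJ; rewrite mem_head.
- exact: mp_jirr rq.
- by apply: sJ; rewrite inE us orbT.
Qed.

Lemma is_node_uniq (s : seq K) :
  ~ (exists t : seq K, D_cycle t) -> is_node s -> uniq s.
Proof.
move=> nD; elim: s => // p s IH sn /=; apply/andP; split; last first.
  by case: s IH sn => // o s IH /is_node_behead/IH.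
apply/negP => ps; case/splitPr: ps sn => s1 s2 {IH}.
(* An immediate repetition is too short for a [D]-cycle, but no minimal pair of [p] contains [p]. *)
case: s1 => [|r s1] sn.
  by case: sn => -[x /mp_nlel]; rewrite lexx.
case: nD; exists (p :: rev (r :: s1)).
have [pth sJ] := is_node_D_path sn.
split; first by rewrite /= size_rev.
- by move=> u; rewrite inE mem_rev => us; apply: sJ; rewrite inE.
- exact: pth.
Qed.

Fixpoint bounded_seqs (T : Type) (l : seq T) n : seq (seq T) :=
  if n is n'.+1 then [::] :: [seq x :: s | x <- l, s <- bounded_seqs l n']
  else [:: [::]].

Lemma mem_bounded_seqs (T : eqType) (l s : seq T) n : (size s <= n)%N ->
  {subset s <= l} -> s \in bounded_seqs l n.
Proof.
elim: n s => [|n IH] [|x s] //= sn sl; rewrite inE /=.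
apply/allpairsP; exists (x, s) => /=; split=> //; first by apply: sl; rewrite mem_head.
by apply: IH => // y ys; apply: sl; rewrite inE ys orbT.
Qed.

(** Nodes are repetition-free, so the size of [K] bounds their length. *)
Lemma finite_tree : finite_set [set: K] -> ~ (exists t : seq K, D_cycle t) ->
  finite_set [set: tree K].
Proof.
move=> /finite_seqP[l lE] nD.
have meml x : x \in l by have : [set: K] x by []; rewrite lE.
pose U := [set` bounded_seqs l (size l)].
apply: (@sub_finite_set _ _ ((fun g : tree K => val g) @^-1` U)).
  move=> g _; apply: mem_bounded_seqs => //.
  by apply: uniq_leq_size => //; apply: is_node_uniq nD (treeP g).
by apply: finite_preimage; [move=> g h _ _; exact: val_inj|exact: finite_seq].
Qed.

End FiniteTree.

(** * Minimal elements in finite lattices *)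

Section FiniteLattice.
Context (d : Order.disp_t) (L : latticeType d).
Hypothesis finL : finite_set [set: L].

Lemma finite_minimal (P : L -> Prop) x : P x ->
  exists y, [/\ y <= x, P y & forall z, P z -> ~~ (z < y)].
Proof.
have [l lE] := (finite_seqP _).1 finL.
have meml z : z \in l by have : [set: L] z by []; rewrite lE.
pose n x := count (fun z => z < x) l.
move E: (n x) => k; elim/ltn_ind: k x E => k IH x nx Px.
have [|/existsNP[z /not_implyP[Pz /negP]]] := pselect (forall z, P z -> ~~ (z < x)).
  by move=> xmin; exists x.
rewrite negbK => zx; have [|y [yz Py ymin]] := IH (n z) _ z erefl Pz; last first.
  by exists y; split=> //; exact: le_trans (ltW zx).
have -> : k = (n z + count (fun u => ((u < x) && ~~ (u < z))%O) l)%N.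
  rewrite -nx /n; elim: (l) => //= u t ->.
  by case uz: (u < z); rewrite ?(lt_trans uz zx) /= ?andbT; lia.
rewrite -addn1 leq_add2l -has_count; apply/hasP; exists z => //.
by rewrite zx ltxx.
Qed.

Lemma finite_minimal_joins : minimal_joins L.
Proof.
move=> p x y pxy.
by have [x' [? ? ?]] := finite_minimal (P := fun z => p <= z `|` y) pxy; exists x'.
Qed.

(** An element minimal among those not below [y] is join-irreducible, since everything strictly
    below it is below [y]. *)
Lemma finite_jirr_separates (x y : L) : ~~ (x <= y) ->
  exists p, [/\ join_irreducible p, p <= x & ~~ (p <= y)].
Proof.
move=> nxy; have [p [px npy pmin]] := finite_minimal (P := fun z => ~~ (z <= y)) nxy.
exists p; split=> //; split=> [/(_ y)|u v pE]; first by rewrite (negPf npy).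
have le_eq w : w <= p -> p <> w -> w <= y.
  move=> wp pw; apply: contraT => /pmin; rewrite lt_neqAle wp andbT negbK.
  by move=> /eqP wE; rewrite wE in pw.
have [->|/le_eq uy] := pselect (p = u); first by left.
have [->|/le_eq vy] := pselect (p = v); first by right.
by move: npy; rewrite pE leUx uy ?vy ?pE ?leUl ?leUr.
Qed.

End FiniteLattice.

(** * Filters *)

(* An empty filter would be a new greatest element, and the embedding would not
   preserve an existing upper bound. *)
Section Filters.
Context (d : Order.disp_t) (L : latticeType d).
Implicit Types (x y z : L).

Definition is_filter (X : set L) :=
  [/\ exists x, X x, forall x y, X x -> x <= y -> X y
    & forall x y, X x -> X y -> X (x `&` y)].

Record filter_of := FilterOf {
  filter_set :> set L;
  filter_setP : `[< is_filter filter_set >] }.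

HB.instance Definition _ := [isSub for filter_set].
HB.instance Definition _ := [Choice of filter_of by <:].

Implicit Types F G H : filter_of.

Lemma filterP F : is_filter F. Proof. exact/asboolP/filter_setP. Qed.

Lemma filter_ex F : exists x, filter_set F x.
Proof. by case: (filterP F). Qed.

Lemma filter_up F x y : filter_set F x -> x <= y -> filter_set F y.
Proof. by case: (filterP F) => _ + _; apply. Qed.

Lemma filter_meet F x y : filter_set F x -> filter_set F y -> filter_set F (x `&` y).
Proof. by case: (filterP F) => _ _; apply. Qed.

Definition filter_le F G : bool := `[< filter_set G `<=` filter_set F >].

Lemma filter_le_refl : reflexive filter_le.
Proof. by move=> F; apply/asboolP. Qed.

Lemma filter_le_trans : transitive filter_le.
Proof.
by move=> G F H /asboolP GF /asboolP HG; apply/asboolP; exact: subset_trans GF.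
Qed.

Lemma filter_le_anti : antisymmetric filter_le.
Proof.
move=> F G /andP[/asboolP GF /asboolP FG]; apply: val_inj.
by apply/seteqP; split.
Qed.

Fact filter_display : Order.disp_t. Proof. exact: Order.Disp tt tt. Qed.

HB.instance Definition _ := Order.Le_isPOrder.Build filter_display filter_of
  filter_le_refl filter_le_anti filter_le_trans.

Lemma filter_leP F G : reflect (filter_set G `<=` filter_set F) (F <= G).
Proof. exact: asboolP. Qed.

Lemma is_filter_meet F G :
  `[< is_filter [set z | exists x y, [/\ filter_set F x, filter_set G y & x `&` y <= z]] >].
Proof.
apply/asboolP; split.
- have [x Fx] := filter_ex F; have [y Gy] := filter_ex G.
  by exists (x `&` y), x, y.
- by move=> z t [x [y [Fx Gy xyz]]] zt; exists x, y; split=> //; exact: le_trans zt.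
- move=> z t [x [y [Fx Gy xyz]]] [x' [y' [Fx' Gy' xyz']]].
  exists (x `&` x'), (y `&` y'); split; [exact: filter_meet|exact: filter_meet|].
  by rewrite meetACA leI2.
Qed.

Lemma is_filter_join F G : `[< is_filter (filter_set F `&` filter_set G)%classic >].
Proof.
apply/asboolP; split.
- have [x Fx] := filter_ex F; have [y Gy] := filter_ex G; exists (x `|` y).
  by split; [exact: filter_up Fx (leUl _ _)|exact: filter_up Gy (leUr _ _)].
- by move=> z t [Fz Gz] zt; split; [exact: filter_up zt|exact: filter_up zt].
- by move=> z t [Fz Gz] [Ft Gt]; split; exact: filter_meet.
Qed.

Lemma filter_meetP F G H :
  (F <= FilterOf (is_filter_meet G H)) = (F <= G) && (F <= H).
Proof.
apply/filter_leP/andP => [GHF|[/filter_leP GF /filter_leP HF] z].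
  have [x Gx] := filter_ex G; have [y Hy] := filter_ex H.
  split; apply/filter_leP => z zP; apply: GHF.
    by exists z, y; split=> //; exact: leIl.
  by exists x, z; split=> //; exact: leIr.
case=> x [y [/GF Fx /HF Fy xyz]].
exact: filter_up (filter_meet Fx Fy) xyz.
Qed.

Lemma filter_joinP F G H :
  (FilterOf (is_filter_join F G) <= H) = (F <= H) && (G <= H).
Proof.
apply/filter_leP/andP => [HFG|[/filter_leP HF /filter_leP HG] z Hz].
  by split; apply/filter_leP => z /HFG[].
by split; [exact: HF|exact: HG].
Qed.

HB.instance Definition _ := Order.POrder_MeetJoin_isLattice.Build filter_display
  filter_of filter_meetP filter_joinP.

End Filters.

(** Formal terms let all three identities pass to filters by one argument. *)
Inductive lterm :=
| LVar of nat
| LMeet of lterm & lterm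
| LJoin of lterm & lterm.

Fixpoint leval (d : Order.disp_t) (L : latticeType d) (v : nat -> L) t : L :=
  match t with
  | LVar n => v n
  | LMeet t1 t2 => leval v t1 `&` leval v t2
  | LJoin t1 t2 => leval v t1 `|` leval v t2
  end.

Lemma leval_mono (d : Order.disp_t) (L : latticeType d) (v w : nat -> L) t :
  (forall n, v n <= w n) -> leval v t <= leval w t.
Proof. by move=> vw; elim: t => //= t1 IH1 t2 IH2; [exact: leI2|exact: leU2]. Qed.

Section FilterIdentities.
Context (d : Order.disp_t) (L : latticeType d).

(** Terms are monotone, so the valuations found for two subterms can be merged by pointwise
    meets. *)
Lemma in_filter_leval (V : nat -> filter_of L) t z : filter_set (leval V t) z <->
  exists2 v : nat -> L, (forall n, filter_set (V n) (v n)) & leval v t <= z.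
Proof.
split; last first.
  elim: t z => [n|t1 IH1 t2 IH2|t1 IH1 t2 IH2] z [v vV] /=.
  - exact: filter_up (vV n).
  - by move=> vz; exists (leval v t1), (leval v t2); split=> //;
      [apply: IH1|apply: IH2]; exists v.
  - by rewrite leUx => /andP[v1 v2]; split; [apply: IH1|apply: IH2]; exists v.
have [v0 v0V] := choice (fun n => filter_ex (V n)).
have glb (v w : nat -> L) t' : leval (fun n => v n `&` w n) t' <= leval v t' /\
    leval (fun n => v n `&` w n) t' <= leval w t'.
  by split; apply: leval_mono => n; rewrite ?leIl ?leIr.
elim: t z => [n|t1 IH1 t2 IH2|t1 IH1 t2 IH2] z /=.
- move=> Vz; exists (fun m => if m == n then z else v0 m); last by rewrite eqxx.
  by move=> m; case: eqP => // ->.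
- case=> x [y [/IH1[v vV vx] /IH2[w wV wy] xyz]].
  exists (fun n => v n `&` w n) => [n|]; first exact: filter_meet.
  rewrite (le_trans _ xyz) // leI2 //.
    exact: le_trans (glb v w t1).1 vx.
  exact: le_trans (glb v w t2).2 wy.
- case=> /IH1[v vV vx] /IH2[w wV wy].
  exists (fun n => v n `&` w n) => [n|]; first exact: filter_meet.
  rewrite leUx (le_trans (glb v w t1).1 vx) //=.
  exact: le_trans (glb v w t2).2 wy.
Qed.

Lemma filter_identity (t1 t2 : lterm) : (forall v : nat -> L, leval v t1 = leval v t2) ->
  forall V : nat -> filter_of L, leval V t1 = leval V t2.
Proof.
move=> t12 V; apply: val_inj; apply/seteqP; split=> z /in_filter_leval[v vV vz];
  by apply/in_filter_leval; exists v; rewrite // ?t12 // -t12.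
Qed.

(** For (U), which has four variables, the value [x4] is arbitrary. *)
Definition env (T : Type) (x0 x1 x2 x3 x4 : T) (n : nat) : T :=
  match n with 0 => x0 | 1 => x1 | 2 => x2 | 3 => x3 | _ => x4 end.

Let X n := LVar n.
Let M s t := LMeet s t.
Let J s t := LJoin s t.

Lemma filter_identity_S : identity_S L -> identity_S (filter_of L).
Proof.
move=> LS a b b0 b1 c.
pose b' := M (X 1) (J (X 2) (X 3)).
pose r bi := M (M (X 0) (J bi (X 4))) (J (M b' (J (X 0) bi)) (X 4)).
apply: (@filter_identity (M (X 0) (J b' (X 4)))
  (J (M (X 0) b') (J (r (X 2)) (r (X 3)))) _ (env a b b0 b1 c)).
by move=> v; exact: LS.
Qed.

Lemma filter_identity_U : identity_U L -> identity_U (filter_of L).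
Proof.
move=> LU x x0 x1 x2.
apply: (@filter_identity
  (M (M (M (X 0) (J (X 1) (X 2))) (J (X 2) (X 3))) (J (X 1) (X 3)))
  (J (J (M (M (X 0) (X 1)) (J (X 2) (X 3))) (M (M (X 0) (X 2)) (J (X 1) (X 3))))
     (M (M (X 0) (X 3)) (J (X 1) (X 2)))) _ (env x x0 x1 x2 x)).
by move=> v; exact: LU.
Qed.

Lemma filter_identity_B : identity_B L -> identity_B (filter_of L).
Proof.
move=> LB x a0 a1 b0 b1.
pose a01 := J (X 1) (X 2); pose b01 := J (X 3) (X 4).
apply: (@filter_identity (M (M (X 0) a01) b01)
  (J (J (J (M (M (X 0) (X 1)) b01) (M (M (X 0) (X 3)) a01))
        (J (M (M (X 0) (X 2)) b01) (M (M (X 0) (X 4)) a01)))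
     (J (M (M (M (M (X 0) a01) b01) (J (X 1) (X 3))) (J (X 2) (X 4)))
        (M (M (M (M (X 0) a01) b01) (J (X 1) (X 4))) (J (X 2) (X 3)))))
  _ (env x a0 a1 b0 b1)).
by move=> v; exact: LB.
Qed.

End FilterIdentities.

(** * The embedding by principal filters *)

Section FilterEmbedding.
Context (d : Order.disp_t) (L : latticeType d).

(** Zorn's lemma for reverse inclusion: the union of a nonempty chain of filters is a filter and a
    lower bound. *)
Lemma minimal_filter (P : set (filter_of L)) F : P F ->
  (forall (C : set (filter_of L)) U, C `<=` P ->
    filter_set U = \bigcup_(G in C) filter_set G -> P U) ->
  exists G, P G /\ forall H, P H -> ~~ (H < G).
Proof.
move=> PF PU; pose R (G H : {G | P G}) := sval H <= sval G.
have [| | | |[G PG] Gmax] := @Zorn _ R.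
- by move=> G; exact: lexx.
- by move=> G H K HG KH; exact: le_trans KH HG.
- by move=> [G PG] [H PH] HG GH; apply/eq_exist/le_anti/andP.
- move=> A totA; have [[G0 AG0]|A0] := pselect (exists G, A G); last first.
    by exists (exist _ F PF) => G AG; case: A0; exists G.
  pose C := [set sval G | G in A].
  have UF : `[< is_filter (\bigcup_(G in C) filter_set G) >].
    apply/asboolP; split.
    - have [x Gx] := filter_ex (sval G0).
      by exists x, (sval G0) => //; exists G0.
    - by move=> x y [G CG Gx] xy; exists G => //; exact: filter_up Gx xy.
    - move=> x y [_ [G AG <-] Gx] [_ [H AH <-] Hy].
      case: (totA G H AG AH) => /filter_leP GH.
        exists (sval H); first by exists H.
        by apply: filter_meet => //; exact: GH.
      exists (sval G); first by exists G.
      by apply: filter_meet => //; exact: GH.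
  have PC : P (FilterOf UF).
    by apply: (PU C) => // _ [[G PG] _ <-].
  exists (exist _ _ PC) => G AG; apply/filter_leP => x Gx /=.
  by exists (sval G) => //; exists G.
exists G; split=> // H PH; apply/negP => HG.
have := Gmax (exist _ H PH) (ltW HG).
by move=> /(congr1 sval) /= HE; rewrite HE ltxx in HG.
Qed.

(** That [F] is below the join of [X] and [H] means that [F] contains their intersection, a
    condition on single elements of [X], hence stable under unions. *)
Lemma filter_minimal_joins : minimal_joins (filter_of L).
Proof.
move=> F G H FGH; pose P := [set X : filter_of L | X <= G /\ F <= X `|` H].
have [|C U CP UE|X [[XG FX] Xmin]] := @minimal_filter P G; first by split.
  have [[X CX]|C0] := pselect (exists X, C X); last first.
    have [x] := filter_ex U; rewrite UE => -[X CX _].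
    by case: C0; exists X.
  split; apply/filter_leP => x.
    have [/filter_leP XG _] := CP X CX.
    by move=> /XG Xx; rewrite UE; exists X.
  case=> Ux Hx; have : filter_set U x by [].
  by rewrite UE => -[Y /CP[_ /filter_leP FY] Yx]; apply: FY.
exists X; split=> // Y FY; apply/negP => YX.
by have /negP := Xmin Y (conj (le_trans (ltW YX) XG) FY).
Qed.

Lemma is_filter_principal (x : L) : `[< is_filter [set y | x <= y] >].
Proof.
apply/asboolP; split; first by exists x => /=.
- by move=> y z /= xy yz; exact: le_trans yz.
- by move=> y z /= xy xz; rewrite lexI xy.
Qed.

Definition principal x : filter_of L := FilterOf (is_filter_principal x).

Lemma principalI : Order.meet_morphism principal.
Proof.
move=> x y; apply: val_inj; apply/seteqP; split=> z /=.
  by move=> xyz; exists x, y; split=> /=.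
case=> x' [y' [/= xx' yy' xyz]]; apply: (le_trans _ xyz).
exact: leI2.
Qed.

Lemma principalU : Order.join_morphism principal.
Proof.
by move=> x y; apply: val_inj; apply/seteqP; split=> z /=; rewrite leUx => /andP.
Qed.

Lemma principal_bot z : (forall x, z <= x) -> forall F, principal z <= F.
Proof. by move=> zb F; apply/filter_leP => x _ /=. Qed.

Lemma principal_top z : (forall x, x <= z) -> forall F, F <= principal z.
Proof.
move=> zt F; apply/filter_leP => x /= zx; have [y Fy] := filter_ex F.
by apply: (filter_up Fy); exact: le_trans (zt y) zx.
Qed.

(** The required [F] is a filter maximal for inclusion among those containing [x] but not [y]. *)
Lemma filter_jirr_separates (x y : L) : ~~ (x <= y) ->
  exists F, [/\ join_irreducible F, F <= principal x & ~~ (F <= principal y)].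
Proof.
move=> nxy; pose P := [set F | F <= principal x /\ ~~ (F <= principal y)].
have prE F z : F <= principal z <-> filter_set F z.
  split=> [/filter_leP|Fz]; first by apply => /=.
  by apply/filter_leP => t /= zt; exact: filter_up Fz zt.
have [|C U CP UE|F [[Fx Fy] Fmin]] := @minimal_filter P (principal x).
- by split=> //; apply/negP => /prE /=; rewrite (negPf nxy).
- have [[X CX]|C0] := pselect (exists X, C X); last first.
    have [z] := filter_ex U; rewrite UE => -[X CX _].
    by case: C0; exists X.
  split; first by apply/prE; rewrite UE; exists X => //; apply/prE; case: (CP X CX).
  apply/negP => /prE; rewrite UE => -[Y CY /prE Yy].
  by have [_] := CP Y CY; rewrite Yy.
exists F; split=> //; split=> [Fbot|G H FE]; first by rewrite Fbot in Fy.
have le_eq G' : G' <= F -> F <> G' -> G' <= principal y.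
  move=> GF FG; apply: contraT => Gy.
  have := Fmin G' (conj (le_trans GF Fx) Gy).
  by rewrite lt_neqAle GF andbT negbK => /eqP GE; rewrite GE in FG.
have [->|/le_eq Gy] := pselect (F = G); first by left.
have [->|/le_eq Hy] := pselect (F = H); first by right.
by move: Fy; rewrite FE leUx Gy ?Hy ?FE ?leUl ?leUr.
Qed.

End FilterEmbedding.

Theorem theorem7p7 (d : Order.disp_t) (L : latticeType d) :
  [<-> exists (d' : Order.disp_t) (P : porderType d')
         (f : {lmorphism L -> Co P}), injective f;
       [/\ identity_S L, identity_U L & identity_B L];
       exists (d' : Order.disp_t) (Gamma : porderType d'),
         [/\ tree_like Gamma,
             exists f : {lmorphism L -> Co Gamma},
               injective f /\ preserves_existing_bounds f
           & finite_set [set: L] -> ~ (exists s : seq L, D_cycle s) ->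
             finite_set [set: Gamma]]].
Proof.
tfae.
- move=> [d' [P [f injf]]]; apply: (identities_embedding injf).
  by split; [exact: Co_identity_S|exact: Co_identity_U|exact: Co_identity_B].
(* A finite [L] serves as its own [K], so that the absence of [D]-cycles in [L] bounds the tree; for
   infinite [L] the finiteness claim is vacuous. *)
- move=> [LS LU LB]; have [finL|infL] := pselect (finite_set [set: L]).
    exists (tree_display), (tree L : porderType _).
    split; [exact: tree_tree_like| |exact: finite_tree].
    apply: (representation LS LU LB (finite_minimal_joins finL) (i := id)) => //.
    exact: finite_jirr_separates.
  exists (tree_display), (tree (filter_of L) : porderType _).
  split; [exact: tree_tree_like| |by []].
  apply: (representation _ _ _ (@filter_minimal_joins _ L) (i := @principal _ L)).
  + exact: filter_identity_S.
  + exact: filter_identity_U.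
  + exact: filter_identity_B.
  + exact: principalI.
  + exact: principalU.
  + exact: principal_bot.
  + exact: principal_top.
  + exact: filter_jirr_separates.
- by move=> [d' [P [_ [f [injf _]] _]]]; exists d', P, f.
Qed.
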